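(* Let $3<p<\infty$ and $\frac1p+\frac1q=1$. Let $\mathcal J:l_p\to l_q$ be the mapping $\mathcal J(x)=(|t_1|^{p-1}\mathrm{sign}(t_1),|t_2|^{p-1}\mathrm{sign}(t_2),\dots)$ for $x=(t_1,t_2,\dots)\in l_p$. Then $\mathcal J$ is Mordukhovich differentiable in $l_p$ and, for $\bar x=\{\bar t_n\}_{n=1}^\infty\in l_p$, the Mordukhovich derivative $\widehat D^*\mathcal J(\bar x):l_p\to l_q$ is equal to the Fréchet derivative $\nabla\mathcal J(\bar x):l_p\to l_q$, with the representation $$\widehat D^*\mathcal J(\bar x)=\nabla\mathcal J(\bar x)=(p-1)\begin{pmatrix}|\bar t_1|^{p-2}&0&\cdots\\0&|\bar t_2|^{p-2}&0\\\vdots&0&\ddots\end{pmatrix}.$$ More precisely, $\widehat D^*\mathcal J(\bar x)=\nabla\mathcal J(\bar x):l_p\to l_q$ is a pointwise multiplication operator in $l_p$ and, for any $v=\{t_n\}_{n=1}^\infty\in l_p$, $$\widehat D^*\mathcal J(\bar x)(v)=\nabla\mathcal J(\bar x)(v)=\{(p-1)|\bar t_n|^{p-2}t_n\}_{n=1}^\infty\in l_q.$$ Furthermore, for any $v=\{t_n\}_{n=1}^\infty\in l_p$ and $y=\{s_n\}_{n=1}^\infty\in l_p$, $$\langle\widehat D^*\mathcal J(\bar x)(y),v\rangle=\langle y,\nabla\mathcal J(\bar x)(v)\rangle=(p-1)\sum_{n=1}^\infty|\bar t_n|^{p-2}s_nt_n.$$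
   Context: $(l_p,\|\cdot\|_p)$ and $(l_q,\|\cdot\|_q)$ are the real sequence spaces, $l_p^*=l_q$, $l_q^*=l_p$, and $\langle\cdot,\cdot\rangle$ is the canonical real pairing $\sum_n a_nb_n$ of elements of $l_q$ and $l_p$ (in either order). Infinite diagonal matrices act on sequences (viewed as row vectors) by entrywise multiplication by the diagonal entries. $\nabla\mathcal J(\bar x)$ is the Fréchet derivative of $\mathcal J$ at $\bar x$. The Mordukhovich derivative (Fréchet coderivative) of $\mathcal J$ at $\bar x$ is the set-valued map $\widehat D^*\mathcal J(\bar x)=\widehat D^*\mathcal J(\bar x,\mathcal J(\bar x)):l_p\rightrightarrows l_q$, $$\widehat D^*\mathcal J(\bar x)(y)=\left\{z\in l_q:\limsup_{u\to\bar x,\,u\in l_p}\frac{\langle z,u-\bar x\rangle-\langle y,\mathcal J(u)-\mathcal J(\bar x)\rangle}{\|u-\bar x\|_p+\|\mathcal J(u)-\mathcal J(\bar x)\|_q}\le0\right\},\quad y\in l_p.$$ $\mathcal J$ is Mordukhovich differentiable in $l_p$ if for every $\bar x\in l_p$ this set is a singleton for every $y\in l_p$; the singleton is then identified with its unique element. *)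

(* Defs.v *)
From HB Require Import structures.
From mathcomp Require Import all_boot all_order all_algebra.
From mathcomp Require Import all_classical all_reals all_analysis.

Set Implicit Arguments.
Unset Strict Implicit.
Unset Printing Implicit Defensive.
Import Order.TTheory GRing.Theory Num.Theory.
Import numFieldNormedType.Exports.

Local Open Scope classical_set_scope.
Local Open Scope ring_scope.

(* The real sequence space l_p (1 <= p < oo), as functions nat -> R with finite
   L^p norm for the counting measure; [LfunType] identifies functions only when
   they are equal everywhere, so no almost-everywhere quotient is involved.
   Sequences are indexed from 0. *)
Definition ell (R : realType) (p : R) (p1 : 1 <= p) : Type :=
  LfunType (@counting nat R) (p1 : (1 <= p%:E)%E).

Section ell_normed.
Context (R : realType) (p : R) (p1 : 1 <= p).
Local Notation E := (ell p1).
Implicit Types x y : E.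

HB.instance Definition _ := GRing.Lmodule.on E.

Definition ell_norm x : R := fine ('N[counting]_p%:E[EFin \o x])%E.

Lemma ell_normD x y : ell_norm (x + y) <= ell_norm x + ell_norm y.
Proof. exact: ler_LnormD. Qed.

Lemma ell_normZ (a : R) x : ell_norm (a *: x) = `|a| * ell_norm x.
Proof.
apply: EFin_inj; rewrite EFinM /ell_norm !finite_norm_fine.
exact: LnormZ.
Qed.

Lemma ell_norm_sumE x :
  ((ell_norm x)%:E = (\sum_(n <oo) (`|x n| `^ p)%:E) `^ p^-1)%E.
Proof. by rewrite /ell_norm finite_norm_fine Lnorm_counting ?(lt_le_trans ltr01). Qed.

Lemma ell_ext x y : (forall n, x n = y n) -> x = y.
Proof. by move=> xy; apply/LfuneqP. Qed.

Lemma ell_norm0_eq0 x : ell_norm x = 0 -> x = 0.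
Proof.
have p0 : 0 < p by rewrite (lt_le_trans ltr01).
move=> x0; apply: ell_ext => n.
have u0 (k : nat) : (0 <= (`|x k| `^ p)%:E)%E by rewrite lee_fin powR_ge0.
have := ell_norm_sumE x; rewrite x0 => /esym/poweR_eq0_eq0 s0.
have {}s0 := s0 (nneseries_ge0 (fun k _ _ => u0 k)).
have := @nneseries_lim_ge R _ xpredT 0 n.+1 (fun k _ _ => u0 k).
rewrite s0 big_nat_recr//= => h.
have /eqP : `|x n| `^ p = 0.
  apply/eqP; rewrite eq_le powR_ge0 andbT -lee_fin; apply: le_trans h.
  by rewrite leeDr// sume_ge0.
by rewrite powR_eq0 normr_eq0 => /andP[/eqP].
Qed.

HB.instance Definition _ :=
  Lmodule_isNormed.Build R E ell_normD ell_normZ ell_norm0_eq0.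

Lemma ell_normE x :
  ((`|x|)%:E = (\sum_(n <oo) (`|x n| `^ p)%:E) `^ p^-1)%E.
Proof. exact: ell_norm_sumE. Qed.

Lemma ell_sum_lty x : (\sum_(n <oo) (`|x n| `^ p)%:E < +oo)%E.
Proof.
have p0 : 0 < p by rewrite (lt_le_trans ltr01).
apply: (@lty_poweRy _ _ p^-1); first by rewrite gt_eqF// invr_gt0.
by rewrite -ell_normE ltry.
Qed.

Lemma mem_Lfun_counting (f : nat -> R) :
  (\sum_(n <oo) (`|f n| `^ p)%:E < +oo)%E -> f \in Lfun counting p%:E.
Proof.
move=> fy; apply/andP; split; rewrite inE//.
rewrite /= /finite_norm Lnorm_counting ?(lt_le_trans ltr01)//.
exact: poweR_lty.
Qed.

Definition mk_ell (f : nat -> R)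
    (fy : (\sum_(n <oo) (`|f n| `^ p)%:E < +oo)%E) : E :=
  Lfun_Sub (p1 : (1 <= p%:E)%E) (mem_Lfun_counting fy).

Lemma mk_ellE f fy n : @mk_ell f fy n = f n.
Proof. by []. Qed.

End ell_normed.

Section pairing.
Context (R : realType) (p q : R) (p1 : 1 <= p) (q1 : 1 <= q).

Definition pairing (a : ell p1) (b : ell q1) : R :=
  limn (series (fun n => a n * b n)).

(* By Hoelder's inequality the limit defining [pairing] exists. *)
Lemma is_cvg_pairing (a : ell p1) (b : ell q1) :
  p^-1 + q^-1 = 1 -> cvgn (series (fun n => a n * b n)).
Proof.
move=> pq.
have p0 : 0 < p by rewrite (lt_le_trans ltr01).
have q0 : 0 < q by rewrite (lt_le_trans ltr01).
have := @hoelder _ _ R (@counting nat R) a b p q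
  (@measurable_funPT _ _ _ _ a) (@measurable_funPT _ _ _ _ b) p0 q0 pq.
rewrite Lnorm1 ge0_integral_count//= => h.
have ab : (\sum_(n <oo) (`|a n * b n|)%:E < +oo)%E.
  apply: le_lt_trans h _.
  rewrite -(finite_norm_fine a) -(finite_norm_fine b) -EFinM; exact: ltry.
apply: normed_cvg.
rewrite /normed_series_of/=.
have := @summable_cvg R xpredT (fun n => (`|a n * b n|)%:E).
apply => //; rewrite summableE -nneseries_esum//.
rewrite ge0_fin_numE; last by apply: nneseries_ge0.
by under eq_eseriesr do rewrite /= normr_id.
Qed.

End pairing.

Section coderivative.
Context (R : realType) (p q : R) (p1 : 1 <= p) (q1 : 1 <= q).
Implicit Types F : ell p1 -> ell q1.

(* For conjugate exponents p and q, the dual of l_p is l_q and the dual of l_q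
   is l_p, so that the coderivative of a map from l_p to l_q is a set-valued
   map from l_p to l_q. The limsup is over u -> x with u <> x. *)
Definition coderivative F (x y : ell p1) : set (ell q1) :=
  [set z : ell q1 |
    (limf_esup (fun u : ell p1 =>
      ((pairing z (u - x) - pairing y (F u - F x)) /
       (`|u - x| + `|F u - F x|))%:E) x^' <= 0)%E].

Definition mordukhovich_differentiable F : Prop :=
  forall x y, exists z, coderivative F x y = [set z].

(* The unique element of [coderivative F x y] when it is a singleton. *)
Definition mordukhovich_derivative F (x y : ell p1) : ell q1 :=
  get (coderivative F x y).

Definition pointwise_multiplication (T : ell p1 -> ell q1) : Prop :=
  exists m : nat -> R, forall v n, T v n = m n * v n.

End coderivative.

Section infinite_matrix.
Context (R : realType).

Definition infdiag (d : nat -> R) : nat -> nat -> R :=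
  fun i j => if i == j then d i else 0.

Definition rowmul (v : nat -> R) (A : nat -> nat -> R) : nat -> R :=
  fun j => limn (series (fun i => v i * A i j)).

(* Infinite diagonal matrices act on row vectors by entrywise multiplication. *)
Lemma rowmul_infdiag (v d : nat -> R) :
  rowmul v (infdiag d) = fun n => v n * d n.
Proof.
apply/funext => j; apply/cvg_lim => //.
apply: (@cvg_near_cst _ _ _ _ _ _ _); exists j.+1 => // n /= jn.
rewrite /series/= big_mkord (bigD1 (Ordinal jn))//= /infdiag eqxx big1 ?addr0//.
by move=> i; rewrite -val_eqE/= => /negPf ->; rewrite mulr0.
Qed.

End infinite_matrix.

Lemma gt3_ge1 (R : realType) (p : R) : 3 < p -> 1 <= p.
Proof. by move=> p3; rewrite (le_trans _ (ltW p3))// ler1n. Qed.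

Lemma gt3_conj_ge1 (R : realType) (p q : R) :
  3 < p -> p^-1 + q^-1 = 1 -> 1 <= q.
Proof.
move=> p3 pq.
have p0 : 0 < p by rewrite (lt_le_trans ltr01)// gt3_ge1.
have p1 : 1 < p by rewrite (lt_trans _ p3)// ltr1n.
have qE : q^-1 = 1 - p^-1 by rewrite -pq addrAC subrr add0r.
have qV : 0 < q^-1 by rewrite qE subr_gt0 invf_lt1.
have q0 : 0 < q by rewrite -invr_gt0.
by rewrite -(invf_le1 q0) qE gerBl invr_ge0 ltW.
Qed.

Section Jmap.
Context (R : realType) (p q : R) (p1 : 1 <= p) (q1 : 1 <= q).
Context (pq : p^-1 + q^-1 = 1).

Definition Jseq (x : nat -> R) (n : nat) : R :=
  `|x n| `^ (p - 1) * Num.sg (x n).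

Lemma Jseq_lty (x : ell p1) : (\sum_(n <oo) (`|Jseq x n| `^ q)%:E < +oo)%E.
Proof.
have p0 : 0 < p by rewrite (lt_le_trans ltr01).
have q0 : 0 < q by rewrite (lt_le_trans ltr01).
have pqE : (p - 1) * q = p.
  have : (p^-1 + q^-1) * (p * q) = p * q by rewrite pq mul1r.
  rewrite mulrDl mulrA mulVf ?gt_eqF// mul1r mulrCA mulVf ?gt_eqF// mulr1.
  by move=> h; rewrite mulrBl mul1r -h addrC addKr.
apply: le_lt_trans (ell_sum_lty x).
apply: lee_nneseries => [n _ _|n _]; rewrite lee_fin ?powR_ge0//.
rewrite /Jseq normrM normr_sg ger0_norm ?powR_ge0//.
have [->|xn0] := eqVneq (x n) 0.
  by rewrite mulr0 powR0 ?gt_eqF// powR_ge0.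
by rewrite mulr1 -powRrM pqE.
Qed.

Definition Jmap (x : ell p1) : ell q1 := mk_ell q1 (Jseq_lty x).

Lemma JmapE x n : Jmap x n = `|x n| `^ (p - 1) * Num.sg (x n).
Proof. by []. Qed.

End Jmap.

(* Main.v *)
Require Import Defs.
From HB Require Import structures.
From mathcomp Require Import all_boot all_order all_algebra.
From mathcomp Require Import all_classical all_reals all_analysis.
From mathcomp Require Import ring lra.

Set Implicit Arguments.
Unset Strict Implicit.
Unset Printing Implicit Defensive.
Import Order.TTheory GRing.Theory Num.Theory.
Import numFieldNormedType.Exports.

Local Open Scope classical_set_scope.
Local Open Scope ring_scope.

(** The coordinate function of the map is t |-> |t|^r sign t with r = p - 1 > 2.
It is twice differentiable, with a second derivative of order |t|^(r-2), so the
n-th entry of J(x + h) - J(x) - dJ(x) h is at most a constant times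
(|x_n| + |h_n|)^(p-3) h_n^2 ([spowR_taylor2]).  The exponents p - 3 and 2 add up
to p - 1 = p/q, which is exactly what Hoelder's inequality needs to bound the
l_q norm of such a sequence by (|x| + |h|)^(p-3) |h|^2 in l_p norms
([hoelder_powR]).  Hence the remainder is O(|h|^2) and the Frechet derivative of
J at x is the multiplication operator dJ(x) ([Jmap_differentiable]).

For any map F that is Frechet differentiable at x with derivative T, the
coderivative of F at x sends y to the set of all z that satisfy <z, h> = <y, T h>
for every h, in other words to the adjoint T^* y ([coderivative_diff]).  Indeed
the numerator of the defining quotient is <z, h> - <y, T h> + o(|h|) with
h = u - x, and its denominator is squeezed between |h| and a multiple of |h|.  A
multiplication operator is its own adjoint for the canonical pairing, and unit
sequences separate the points of l_q, so the coderivative of J at x is the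
singleton {dJ(x) y} ([coderivative_Jmap]). *)

(** * Second-order Taylor bounds for real powers *)

Section powR_taylor.
Context (R : realType).
Implicit Types a b r s t M : R.

(** Young's inequality for a and b^(r-1), with conjugate exponents r and
r/(r-1), is the convexity of x^r in disguise; it gives the tangent-line bound
without any differentiation, so that b = 0 needs no separate treatment. *)
Lemma powR_ge_tangent r a b : 1 < r -> 0 <= a -> 0 <= b ->
  r * b `^ (r - 1) * (a - b) <= a `^ r - b `^ r.
Proof.
move=> r1 a0 b0; have r0 : 0 < r by lra.
have r10 : 0 < r - 1 by lra.
have conj : r^-1 + (r / (r - 1))^-1 = 1.
  by rewrite invf_div -{1}[r^-1]mul1r -mulrDl subrKC divff ?gt_eqF.
have := @conjugate_powR R a (b `^ (r - 1)) r (r / (r - 1)) a0 (powR_ge0 _ _) r0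
  (divr_gt0 r0 r10) conj.
rewrite -powRrM mulrCA divff ?gt_eqF// mulr1 invf_div => young.
have bE : b * b `^ (r - 1) = b `^ r by rewrite mulr_powRB1.
have {}young : r * (a * b `^ (r - 1)) <= a `^ r + b `^ r * (r - 1).
  by rewrite mulrC -ler_pdivlMr// mulrDl -(mulrA (b `^ r)).
nra.
Qed.

(** The tangent at the larger of the two points bounds the increment. *)
Lemma powR_sub_le r M a b : 1 < r -> 0 <= a <= M -> 0 <= b <= M ->
  `|a `^ r - b `^ r| <= r * M `^ (r - 1) * `|a - b|.
Proof.
move=> r1 /andP[a0 aM] /andP[b0 bM].
have r10 : 0 <= r - 1 by lra.
have M0 : 0 <= M by exact: le_trans aM.
wlog ba : a b a0 b0 aM bM / b <= a => [hwlog|].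
  have [ba|/ltW ab] := leP b a; first exact: hwlog.
  by rewrite distrC (distrC a); exact: hwlog.
have ab1 := powR_ge_tangent r1 b0 a0.
have abr : b `^ r <= a `^ r by rewrite ge0_ler_powR ?nnegrE//; lra.
have aM1 : a `^ (r - 1) <= M `^ (r - 1) by rewrite ge0_ler_powR ?nnegrE.
rewrite !ger0_norm ?subr_ge0//.
rewrite (@le_trans _ _ (r * a `^ (r - 1) * (a - b)))//; first by lra.
by rewrite ler_wpM2r ?subr_ge0// ler_wpM2l//; lra.
Qed.

(** Adding the tangent inequalities at a and at b traps the remainder between 0
and r (a^(r-1) - b^(r-1)) (a - b), to which the increment bound for the exponent
r - 1 applies. *)
Lemma powR_taylor2 r M a b : 2 < r -> 0 <= a <= M -> 0 <= b <= M ->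
  `|a `^ r - b `^ r - r * b `^ (r - 1) * (a - b)|
    <= r * (r - 1) * M `^ (r - 2) * (a - b) ^+ 2.
Proof.
move=> r2 aM bM.
have [a0 b0] : 0 <= a /\ 0 <= b by case/andP: aM; case/andP: bM.
have r1 : 1 < r by lra.
have ab := powR_ge_tangent r1 a0 b0.
have ba := powR_ge_tangent r1 b0 a0.
rewrite ger0_norm ?subr_ge0//.
have r11 : 1 < r - 1 by lra.
have := powR_sub_le r11 aM bM.
rewrite (_ : r - 1 - 1 = r - 2); last by lra.
move=> dab.
rewrite (@le_trans _ _ (r * ((a `^ (r - 1) - b `^ (r - 1)) * (a - b))))//.
  by lra.
rewrite -2!(mulrA r) ler_wpM2l//; first by lra.
rewrite (le_trans (ler_norm _))// normrM -real_normK ?num_real// expr2 mulrA.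
by rewrite ler_wpM2r.
Qed.

Definition spowR r t := `|t| `^ r * Num.sg t.

Lemma spowRN r t : spowR r (- t) = - spowR r t.
Proof. by rewrite /spowR normrN sgrN mulrN. Qed.

Lemma ger0_spowR r t : 0 < r -> 0 <= t -> spowR r t = t `^ r.
Proof.
move=> r0; rewrite /spowR le_eqVlt => /predU1P[<-|t0].
  by rewrite sgr0 mulr0 powR0 ?gt_eqF.
by rewrite gtr0_sg// mulr1 gtr0_norm.
Qed.

Lemma ler0_spowR r t : 0 < r -> t <= 0 -> spowR r t = - (- t) `^ r.
Proof.
by move=> r0 t0; rewrite -[in LHS](opprK t) spowRN ger0_spowR// oppr_ge0.
Qed.

(** When s and t lie on the same side of 0 this is the Taylor bound for powers.
Otherwise |s| and |t| are at most |s - t|, so each of the three terms on the left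
is already of order |s - t|^r, hence of the order of the right-hand side.  The
constant r^2 + 2 dominates both r (r - 1) and r + 2, the latter because r > 2. *)
Lemma spowR_taylor2 r t s : 2 < r ->
  `|spowR r s - spowR r t - r * `|t| `^ (r - 1) * (s - t)|
    <= (r ^+ 2 + 2) * (`|t| + `|s - t|) `^ (r - 2) * (s - t) ^+ 2.
Proof.
move=> r2; have [r0 r1 r20] : [/\ 0 < r, 0 < r - 1 & 0 <= r - 2] by split; lra.
wlog t0 : s t / 0 <= t => [hwlog|].
  have [t0|/ltW t0] := leP 0 t; first exact: hwlog.
  have := hwlog (- s) (- t); rewrite oppr_ge0 => /(_ t0).
  rewrite !spowRN normrN -(opprD s) normrN sqrrN mulrN.
  by rewrite -(opprD (spowR r s)) -opprD normrN.
set m := `|t| + `|s - t|.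
have m0 : 0 <= m by rewrite addr_ge0.
have mr0 : 0 <= m `^ (r - 2) by rewrite powR_ge0.
have [s0|/ltW s0] := leP 0 s.
  rewrite !ger0_spowR// (ger0_norm t0).
  have sm : 0 <= s <= m.
    by rewrite s0/= /m ger0_norm// -{1}(subrKC t s) lerD2l ler_norm.
  have tm : 0 <= t <= m by rewrite t0/= /m ger0_norm// lerDl.
  rewrite (le_trans (powR_taylor2 r2 sm tm))// ler_wpM2r ?sqr_ge0//.
  by rewrite ler_wpM2r//; nra.
rewrite ler0_spowR// ger0_spowR// (ger0_norm t0).
set d := `|s - t|.
have dE : d = t - s by rewrite /d ler0_norm; lra.
have d0 : 0 <= d by rewrite dE; lra.
have le1 : (- s) `^ r <= d `^ r by rewrite ge0_ler_powR ?nnegrE ?(ltW r0)//; lra.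
have le2 : t `^ r <= d `^ r by rewrite ge0_ler_powR ?nnegrE ?(ltW r0)//; lra.
have le3 : t `^ (r - 1) * d <= d `^ r.
  rewrite -(mulr_powRB1 d0 r0) mulrC ler_wpM2l// ge0_ler_powR ?nnegrE ?(ltW r1)//.
  lra.
have le4 : d `^ r <= m `^ (r - 2) * (s - t) ^+ 2.
  rewrite -(mulr_powRB1 d0 r0) -(mulr_powRB1 d0 r1).
  rewrite (_ : r - 1 - 1 = r - 2); last by lra.
  rewrite -(real_normK (num_real (s - t))) -/d mulrA -expr2 mulrC.
  rewrite ler_wpM2r ?sqr_ge0// ge0_ler_powR ?nnegrE//.
  by rewrite /m lerDr.
have ge1 := powR_ge0 (- s) r; have ge2 := powR_ge0 t r.
have ge3 := powR_ge0 t (r - 1).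
set X := m `^ (r - 2) * (s - t) ^+ 2 in le4.
rewrite -(mulrA (r ^+ 2 + 2)) -/X.
have X0 : 0 <= X by rewrite mulr_ge0// sqr_ge0.
have le5 : r * (t `^ (r - 1) * d) <= r ^+ 2 * X.
  rewrite expr2 -mulrA ler_wpM2l ?(ltW r0)// (le_trans le3)// (le_trans le4)//.
  by rewrite ler_peMl//; lra.
have -> : r * t `^ (r - 1) * (s - t) = - (r * (t `^ (r - 1) * d)).
  by rewrite dE; ring.
have ge5 : 0 <= r * (t `^ (r - 1) * d) by rewrite !mulr_ge0// ltW.
by rewrite ler_norml; apply/andP; split; nra.
Qed.

End powR_taylor.

(** * Elements of the sequence spaces *)

Section ell_entries.
Context (R : realType) (p : R) (p1 : 1 <= p).
Implicit Types x y : ell p1.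

Lemma ellD x y n : (x + y) n = x n + y n. Proof. by []. Qed.
Lemma ellB x y n : (x - y) n = x n - y n. Proof. by []. Qed.
Lemma ellZ (c : R) x n : (c *: x) n = c * x n. Proof. by []. Qed.

Lemma ell_abs_lty x : (\sum_(n <oo) (`| `|x n| | `^ p)%:E < +oo)%E.
Proof.
by under eq_eseriesr do rewrite normr_id; exact: ell_sum_lty.
Qed.

(** Taken entrywise so that |x_n| + |h_n| is again the sequence of entries of an
element of l_p, whose norm the triangle inequality controls. *)
Definition ell_abs x : ell p1 := mk_ell p1 (ell_abs_lty x).

Lemma ell_absE x n : ell_abs x n = `|x n|. Proof. by []. Qed.

Lemma norm_ell_abs x : `|ell_abs x| = `|x|.
Proof.
apply: EFin_inj; rewrite !ell_normE.
by under eq_eseriesr do rewrite ell_absE normr_id.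
Qed.

Lemma ell_delta_lty k : (\sum_(n <oo) (`|(n == k)%:R : R| `^ p)%:E < +oo)%E.
Proof.
have p0 : p != 0 by rewrite gt_eqF// (lt_le_trans ltr01).
have f0 (n : nat) : (0 <= (`|(n == k)%:R : R| `^ p)%:E)%E.
  by rewrite lee_fin powR_ge0.
rewrite (nneseriesD1 (n := k) (fun n _ => f0 n))//.
rewrite [X in (_ + X)%E]eseries0; first by rewrite adde0 ltry.
by move=> n _ /= /negbTE ->; rewrite normr0 powR0.
Qed.

Definition ell_delta k : ell p1 := mk_ell p1 (ell_delta_lty k).

End ell_entries.

(** * Hoelder's inequality for products of powers *)

Section hoelder_powers.
Context (R : realType) (p q : R) (p1 : 1 <= p) (q1 : 1 <= q).
Implicit Types (x y : ell p1) (al be C : R).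

Let p0 : 0 < p. Proof. exact: lt_le_trans p1. Qed.
Let q0 : 0 < q. Proof. exact: lt_le_trans q1. Qed.

(** Both sides are the power al q / p of the sum of the |x_n|^p. *)
Lemma Lnorm_powR_ell x al : 0 < al ->
  ('N[@counting nat R]_(p / (al * q))%:E[EFin \o (fun n => `|x n| `^ (al * q))%R]
    = (`|x| `^ (al * q))%:E)%E.
Proof.
move=> al0; have alq0 : 0 < al * q by rewrite mulr_gt0.
rewrite Lnorm_counting ?divr_gt0//.
rewrite -poweR_EFin ell_normE -poweRrM invf_div [in RHS]mulrC.
congr (_ `^ _)%E; apply: eq_eseriesr => n _.
rewrite /= ger0_norm ?powR_ge0// -powRrM mulrCA divff ?gt_eqF//.
by rewrite mulr1.
Qed.

(** Since al q / p + be q / p = 1, the exponents p / (al q) and p / (be q) are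
conjugate, and Hoelder's inequality applies to |x|^(al q) and |y|^(be q).  The
bound is on the sum itself rather than on a norm, so that it also shows that f
belongs to l_q. *)
Lemma hoelder_powR x y al be C (f : nat -> R) :
    0 < al -> 0 < be -> (al + be) * q = p -> 0 <= C ->
    (forall n, `|f n| <= C * `|x n| `^ al * `|y n| `^ be) ->
  (\sum_(n <oo) (`|f n| `^ q)%:E <= ((C * `|x| `^ al * `|y| `^ be) `^ q)%:E)%E.
Proof.
move=> al0 be0 abE C0 fle.
have conj : (p / (al * q))^-1 + (p / (be * q))^-1 = 1.
  by rewrite !invf_div -mulrDl -mulrDl abE divff ?gt_eqF.
have mf (g : nat -> R) : measurable_fun setT g by [].
have := @hoelder _ _ R (@counting nat R) (fun n => `|x n| `^ (al * q))
  (fun n => `|y n| `^ (be * q)) _ _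
  (mf _) (mf _) (divr_gt0 p0 (mulr_gt0 al0 q0))
  (divr_gt0 p0 (mulr_gt0 be0 q0)) conj.
rewrite !Lnorm_powR_ell// Lnorm1 ge0_integral_count// -EFinM => h.
have Cx0 : 0 <= C * `|x| `^ al by rewrite mulr_ge0 ?powR_ge0.
rewrite powRM ?powR_ge0// powRM ?powR_ge0// -2!powRrM -mulrA EFinM.
apply: le_trans (lee_wpmul2l _ h); last by rewrite lee_fin powR_ge0.
rewrite -nneseriesZl; last by move=> n _; rewrite lee_fin.
apply: lee_nneseries => [n _ _|n _]; rewrite lee_fin ?powR_ge0//.
rewrite /= (ger0_norm (mulr_ge0 (powR_ge0 _ _) (powR_ge0 _ _))) 2!powRrM.
rewrite -powRM ?powR_ge0// -powRM ?mulr_ge0 ?powR_ge0// mulrA.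
by rewrite ge0_ler_powR ?nnegrE ?mulr_ge0 ?powR_ge0// ltW.
Qed.

Lemma ell_norm_le (f : ell q1) C : 0 <= C ->
  (\sum_(n <oo) (`|f n| `^ q)%:E <= (C `^ q)%:E)%E -> `|f| <= C.
Proof.
move=> C0 fC; rewrite -lee_fin ell_normE.
have qV0 : 0 <= q^-1 by rewrite invr_ge0 ltW.
have := gt0_ler_poweR qV0 _ _ fC; rewrite !in_itv/= !leey !andbT.
rewrite lee_fin powR_ge0 nneseries_ge0 => [|n _ _]; last first.
  by rewrite lee_fin powR_ge0.
by move=> /(_ isT isT); rewrite -powRrM divff ?gt_eqF// powRr1.
Qed.

End hoelder_powers.

(** * The canonical pairing *)

Section pairing_theory.
Context (R : realType) (p q : R) (p1 : 1 <= p) (q1 : 1 <= q).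
Hypothesis pq : p^-1 + q^-1 = 1.
Implicit Types (a : ell p1) (b : ell q1).

Lemma pairingDr a b b' : pairing a (b + b') = pairing a b + pairing a b'.
Proof.
rewrite /pairing -lim_seriesD; try exact: is_cvg_pairing.
by congr (limn (series _)); apply/funext => n; rewrite ellD mulrDr.
Qed.

Lemma pairingZr a (c : R) b : pairing a (c *: b) = c * pairing a b.
Proof.
rewrite /pairing -[RHS]lim_seriesZ; last exact: is_cvg_pairing.
by congr (limn (series _)); apply/funext => n; rewrite ellZ mulrCA.
Qed.

Lemma pairingNr a b : pairing a (- b) = - pairing a b.
Proof. by rewrite -scaleN1r pairingZr mulN1r. Qed.

Lemma pairingBr a b b' : pairing a (b - b') = pairing a b - pairing a b'.
Proof. by rewrite pairingDr pairingNr. Qed.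

Lemma pairing_delta a k : pairing a (ell_delta q1 k) = a k.
Proof.
apply/cvg_lim => //; apply: (@cvg_near_cst _ _ _ _ _ _ _).
exists k.+1 => // n /= kn.
rewrite /series/= big_mkord (bigD1 (Ordinal kn))//= eqxx mulr1 big1 ?addr0//.
by move=> i; rewrite -val_eqE/= => /negPf ->; rewrite mulr0.
Qed.

Lemma ler_norm_pairing a b : `|pairing a b| <= `|a| * `|b|.
Proof.
have p0 : 0 < p by rewrite (lt_le_trans ltr01).
have q0 : 0 < q by rewrite (lt_le_trans ltr01).
have := @hoelder _ _ R (@counting nat R) a b p q
  (@measurable_funPT _ _ _ _ a) (@measurable_funPT _ _ _ _ b) p0 q0 pq.
rewrite Lnorm1 ge0_integral_count//= !Lnorm_counting// -!ell_normE -EFinM => h.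
have ab n : `|series (fun n => a n * b n) n| <= `|a| * `|b|.
  rewrite -lee_fin; apply: le_trans h.
  apply: le_trans (nneseries_lim_ge (P := xpredT) n _) => //.
  by rewrite /series /= sumEFin lee_fin ler_norm_sum.
have cv := is_cvg_pairing pq (a := a) (b := b).
rewrite ler_norml; apply/andP; split.
  by apply: limr_ge => //; apply: nearW => n; move: (ab n); rewrite ler_norml => /andP[].
by apply: limr_le => //; apply: nearW => n; move: (ab n); rewrite ler_norml => /andP[].
Qed.

End pairing_theory.

(** * Frechet derivatives and remainder estimates *)

Section frechet.
Context (R : realType) (V W : normedModType R).
Implicit Types (F : V -> W) (x : V).

Lemma differentiable_remainder F x : differentiable F x -> forall e : R, 0 < e ->
  \forall u \near x, `|F u - F x - 'd F x (u - x)| <= e * `|u - x|.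
Proof.
move=> dF e e0.
have /eqaddoP := diff_locally dF => /(_ e e0); rewrite !nearE => h.
rewrite (near_shift 0 x) /= subr0; near=> u.
rewrite /= addrK.
have : `|(F \o shift x - (cst (F x) + 'd F x)) u| <= e * `|u| by near: u.
by rewrite /= opprD addrA.
Unshelve. all: by end_near. Qed.

Lemma remainder_differentiable F (T : {linear V -> W}) x : continuous T ->
  (forall e : R, 0 < e ->
     \forall h \near (0 : V), `|F (h + x) - F x - T h| <= e * `|h|) ->
  differentiable F x /\ 'd F x = T :> (V -> W).
Proof.
move=> cT rem.
have oF : F \o shift x = cst (F x) + T +o_ 0 id.
  apply/eqaddoP => e e0; apply: filterS (rem e e0) => h.
  by rewrite /= -[(_ - _) h]/(F (h + x) - (F x + T h)) opprD addrA.
have dE := diff_unique cT oF; split => //.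
by apply/diff_locallyP; rewrite dE.
Qed.

End frechet.

(** * The coderivative of a Frechet differentiable map *)

Section coderivative_of_differentiable.

Lemma limf_esup_le0P (R : realType) (T : topologicalType) (F : set_system T)
    (FF : Filter F) (g : T -> R) :
  (limf_esup (fun u => (g u)%:E) F <= 0)%E <->
  forall e, 0 < e -> \forall u \near F, g u <= e.
Proof.
rewrite limf_esupE; split => [inf0 e e0|ge].
  have : (ereal_inf [set ereal_sup ((fun u => (g u)%:E) @` V) | V in F] < e%:E)%E.
    by rewrite (le_lt_trans inf0)// lte_fin.
  move=> /ereal_inf_lt[_ [V FV <-] Ve]; apply: filterS FV => u Vu.
  rewrite -lee_fin (le_trans _ (ltW Ve))//; apply: ereal_sup_ubound.
  by exists u.
apply/lee_addgt0Pr => e e0; rewrite add0e.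
have := ge e e0; rewrite nearE => Fe.
apply: (@le_trans _ _ (ereal_sup ((fun u => (g u)%:E) @` [set u | g u <= e]))).
  by apply: ereal_inf_lbound; exists [set u | g u <= e].
by apply: ge_ereal_sup => _ [u ue <-]; rewrite lee_fin.
Qed.

Context (R : realType) (p q : R) (p1 : 1 <= p) (q1 : 1 <= q).
Hypothesis pq : p^-1 + q^-1 = 1.
Implicit Types (F : ell p1 -> ell q1) (x y : ell p1).

(** Write D(h) = <z, h> - <y, 'd F x h>, a linear form.  If D = 0, only
-<y, remainder> is left in the numerator, which is o(|u - x|), while the
denominator is at least |u - x|.  Conversely, along u = x + s h with s > 0 small
the quotient is at least (s D(h) - o(s)) over a fixed multiple of s, so a
nonpositive limsup forces D(h) <= 0; applied to h and to - h it gives D = 0. *)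
Lemma coderivative_diff F x y : differentiable F x ->
  coderivative F x y =
    [set z | forall h, pairing z h = pairing y ('d F x h)].
Proof.
move=> dF; have qp : q^-1 + p^-1 = 1 by rewrite addrC.
have rem := differentiable_remainder dF.
apply/seteqP; split => z; rewrite /coderivative /= => hz; last first.
  apply/limf_esup_le0P => e e0.
  have e1 : 0 < e / (`|y| + 1) by rewrite divr_gt0// ltr_wpDl.
  apply: (filterS _ (nbhs_dnbhs (rem _ e1))) => u Ru.
  have -> : pairing z (u - x) - pairing y (F u - F x) =
            - pairing y (F u - F x - 'd F x (u - x)).
    by rewrite [in RHS](pairingBr pq) opprB hz.
  have num : - pairing y (F u - F x - 'd F x (u - x)) <= e * `|u - x|.
    rewrite (le_trans (ler_norm _))// normrN (le_trans (ler_norm_pairing pq _ _))//.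
    rewrite (le_trans (ler_wpM2l (normr_ge0 y) Ru))// mulrA ler_wpM2r//.
    by rewrite mulrCA ler_piMr ?(ltW e0)// ler_pdivrMr ?ltr_wpDl// mul1r lerDl.
  (* At u = x the quotient is 0 / 0 = 0. *)
  have [->|ux] := eqVneq u x.
    by rewrite !subrr !normr0 addr0 invr0 mulr0 ltW.
  rewrite ler_pdivrMr ?ltr_pwDl ?normr_gt0 ?subr_eq0//.
  by rewrite (le_trans num)// ler_wpM2l ?(ltW e0)// lerDl.
suff hle h : pairing z h <= pairing y ('d F x h).
  move=> h; apply/eqP; rewrite eq_le hle/=.
  by have := hle (- h); rewrite linearN (pairingNr qp) (pairingNr pq) lerN2.
have [->|h0] := eqVneq h 0.
  by rewrite linear0 -(scale0r 0) (pairingZr qp) -[X in pairing y X](scale0r 0)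
     (pairingZr pq) !mul0r.
have [M M0 dM] : exists2 M : R, 0 < M & forall v, `|'d F x v| <= M * `|v|.
  have /linear_bounded_continuous/linear_boundedP/pinfty_ex_gt0[M M0 dM] :=
    diff_continuous dF.
  by exists M.
have nh0 : 0 < `|h| by rewrite normr_gt0.
(* If the quotient and the relative remainder are both at most d <= 1, then
   D(h) <= d * K, because the denominator is at most s |h| (2 + M) and the
   remainder contributes at most d |y| s |h|. *)
pose K := `|h| * (`|y| + 2 + M).
have K0 : 0 < K by rewrite mulr_gt0// ltr_wpDl// addr_ge0.
rewrite -subr_le0; apply/ler_addgt0Pr => e e0; rewrite add0r.
pose d := Num.min 1 (e / K).
have d0 : 0 < d by rewrite lt_min ltr01 divr_gt0.
have d1 : d <= 1 by rewrite ge_min lexx.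
have dK : d * K <= e by rewrite -ler_pdivlMr// ge_min lexx orbT.
apply: le_trans dK.
have : nbhs x [set u | `|F u - F x - 'd F x (u - x)| <= d * `|u - x| /\
    (u != x -> (pairing z (u - x) - pairing y (F u - F x)) /
               (`|u - x| + `|F u - F x|) <= d)].
  by apply: filterI; [exact: rem|exact: (limf_esup_le0P _ _).1 hz _ d0].
move=> /nbhs_normP[r /= r0 near_x].
pose s := r / 2 / `|h|.
have s0 : 0 < s by rewrite !divr_gt0.
have shx : x + s *: h - x = s *: h by rewrite addrAC subrr add0r.
have [] := near_x (x + s *: h).
  rewrite /= opprD addNKr normrN normrZ gtr0_norm// divfK ?gt_eqF//.
  by rewrite ltr_pdivrMr// ltr_pMr// ltr1n.
rewrite shx linearZ/=.
set Fu := F (x + s *: h) - F x; set Rm := Fu - s *: 'd F x h => Rs.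
have shE : `|s *: h| = s * `|h| by rewrite normrZ gtr0_norm.
have FuE : Fu = Rm + s *: 'd F x h by rewrite subrK.
have sh0 : 0 < s * `|h| by rewrite mulr_gt0.
have -> : x + s *: h != x.
  by rewrite -subr_eq0 shx scaler_eq0 negb_or gt_eqF.
move=> /(_ isT); rewrite shE ler_pdivrMr ?ltr_pwDl//.
rewrite (pairingZr qp) {1}FuE (pairingDr pq) (pairingZr pq).
have yR : pairing y Rm <= `|y| * (d * (s * `|h|)).
  rewrite (le_trans (ler_norm _))// (le_trans (ler_norm_pairing pq _ _))//.
  by rewrite ler_wpM2l// -shE.
have nFu : `|Fu| <= d * (s * `|h|) + s * (M * `|h|).
  rewrite FuE (le_trans (ler_normD _ _))// lerD -?shE// normrZ gtr0_norm//.
  by rewrite ler_wpM2l ?(ltW s0).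
move=> quot; rewrite -(ler_pM2l s0).
have dFu := ler_wpM2l (ltW d0)
  (le_trans nFu (lerD (ler_wpM2r (ltW sh0) d1) (lexx _))).
apply: (@le_trans _ _ (d * (s * `|h|) + d * `|Fu| + `|y| * (d * (s * `|h|)))).
  by lra.
by rewrite /K; lra.
Qed.

End coderivative_of_differentiable.

Lemma hoelder_conjugate_subM (R : realType) (p q : R) : 1 <= p -> 1 <= q ->
  p^-1 + q^-1 = 1 -> (p - 1) * q = p.
Proof.
move=> p1 q1 pq; have p0 : p != 0 by rewrite gt_eqF// (lt_le_trans ltr01).
have q0 : q != 0 by rewrite gt_eqF// (lt_le_trans ltr01).
have : (p^-1 + q^-1) * (p * q) = p * q by rewrite pq mul1r.
by rewrite mulrDl mulrA mulVf// mul1r mulrCA mulVf// mulr1; lra.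
Qed.

(** * Differentiability of the power map *)

Section Jmap_derivative.
Context (R : realType) (p q : R) (p1 : 1 <= p) (q1 : 1 <= q).
Context (pq : p^-1 + q^-1 = 1) (p2 : 2 < p).
Implicit Types x y v h : ell p1.

Let pqE : (p - 1) * q = p. Proof. exact: hoelder_conjugate_subM. Qed.

Definition dJseq x v (n : nat) : R := (p - 1) * `|x n| `^ (p - 2) * v n.

Lemma dJseq_le x v n :
  `|dJseq x v n| <= (p - 1) * `|x n| `^ (p - 2) * `|v n| `^ 1.
Proof.
rewrite /dJseq normrM powRr1// ger0_norm// mulr_ge0 ?powR_ge0//.
by rewrite subr_ge0.
Qed.

Lemma dJseq_sum_le x v : (\sum_(n <oo) (`|dJseq x v n| `^ q)%:E <=
  (((p - 1) * `|x| `^ (p - 2) * `|v| `^ 1) `^ q)%:E)%E.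
Proof.
apply: (hoelder_powR q1 _ _ _ _ (dJseq_le x v)); rewrite ?subr_gt0 ?subr_ge0//.
by rewrite -[RHS]pqE; congr (_ * _); ring.
Qed.

Lemma dJseq_lty x v : (\sum_(n <oo) (`|dJseq x v n| `^ q)%:E < +oo)%E.
Proof. by apply: le_lt_trans (dJseq_sum_le x v) _; rewrite ltry. Qed.

(** The multiplication operator with multiplier (p - 1) |x|^(p-2); it is bounded
because (p - 2) + 1 = p / q are admissible exponents in [hoelder_powR]. *)
Definition dJ x v : ell q1 := mk_ell q1 (dJseq_lty x v).

Lemma dJE x v n : dJ x v n = (p - 1) * `|x n| `^ (p - 2) * v n.
Proof. by []. Qed.

Fact dJ_is_linear x : linear (dJ x).
Proof.
move=> c v w; apply: ell_ext => n.
by rewrite ellD ellZ !dJE ellD ellZ; ring.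
Qed.

HB.instance Definition _ x :=
  GRing.isLinear.Build R (ell p1) (ell q1) *:%R (dJ x) (dJ_is_linear x).

Lemma ler_norm_dJ x v : `|dJ x v| <= (p - 1) * `|x| `^ (p - 2) * `|v|.
Proof.
rewrite -[X in _ * X]powRr1//; apply: ell_norm_le; last exact: dJseq_sum_le.
by rewrite !mulr_ge0 ?powR_ge0// subr_ge0.
Qed.

Lemma continuous_dJ x : continuous (dJ x).
Proof.
apply/linear_bounded_continuous/linear_boundedP.
apply: filterS (nbhs_pinfty_ge (num_real ((p - 1) * `|x| `^ (p - 2)))) => r xr v.
by rewrite (le_trans (ler_norm_dJ x v))// ler_wpM2r.
Qed.

Lemma dJ_selfadjoint x y v : pairing (dJ x y) v = pairing y (dJ x v).
Proof.
by congr (limn (series _)); apply/funext => n; rewrite !dJE; ring.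
Qed.

(** The coordinatewise Taylor bound with r = p - 1, summed by [hoelder_powR] with
the exponents p - 3 and 2. *)
Lemma Jmap_remainder_le (p3 : 3 < p) x h :
  `|Jmap q1 pq (h + x) - Jmap q1 pq x - dJ x h| <=
  ((p - 1) ^+ 2 + 2) * `|ell_abs x + ell_abs h| `^ (p - 3) * `|h| `^ 2.
Proof.
apply: ell_norm_le; first by rewrite !mulr_ge0 ?powR_ge0// addr_ge0 ?sqr_ge0.
apply: (hoelder_powR q1) => [||||n]; rewrite ?subr_gt0//.
- by rewrite -[RHS]pqE; congr (_ * _); ring.
- by rewrite addr_ge0 ?sqr_ge0.
rewrite ellB ellB (ellD (ell_abs x)) !ell_absE !JmapE dJE ellD.
have p12 : 2 < p - 1 by lra.
have := spowR_taylor2 (x n) (h n + x n) p12.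
rewrite addrK (_ : p - 1 - 1 = p - 2); last by ring.
rewrite (_ : p - 1 - 2 = p - 3); last by ring.
rewrite powR_mulrn// real_normK ?num_real//.
by rewrite (ger0_norm (addr_ge0 (normr_ge0 (x n)) (normr_ge0 (h n)))).
Qed.

Lemma Jmap_differentiable (p3 : 3 < p) x :
  differentiable (Jmap q1 pq) x /\
  'd (Jmap q1 pq) x = dJ x :> (ell p1 -> ell q1).
Proof.
apply: remainder_differentiable => [|e e0]; first exact: continuous_dJ.
(* For |h| <= 1 the factor (|x| + |h|)^(p-3) is at most (|x| + 1)^(p-3). *)
pose C := ((p - 1) ^+ 2 + 2) * (`|x| + 1) `^ (p - 3).
have C0 : 0 < C by rewrite mulr_gt0 ?powR_gt0 ?ltr_wpDl// ?sqr_ge0.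
near=> h.
have h1 : `|h| <= 1 by near: h; apply: nbhs0_le.
have hC : `|h| <= e / C by near: h; apply: nbhs0_le; rewrite divr_gt0.
rewrite (le_trans (Jmap_remainder_le p3 x h))// powR_mulrn// expr2 mulrA.
rewrite ler_wpM2r// (@le_trans _ _ (C * `|h|))//.
  rewrite ler_wpM2r// ler_wpM2l ?addr_ge0 ?sqr_ge0// ge0_ler_powR ?nnegrE//.
    by lra.
  by rewrite (le_trans (ler_normD _ _))// !norm_ell_abs lerD2l.
by rewrite mulrC -ler_pdivlMr.
Unshelve. all: by end_near. Qed.

(** Pairing with the unit sequences identifies every z such that
<z, h> = <y, dJ x h> = <dJ x y, h> for all h. *)
Lemma coderivative_Jmap (p3 : 3 < p) x y :
  coderivative (Jmap q1 pq) x y = [set dJ x y].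
Proof.
have [dJx dJxE] := Jmap_differentiable p3 x.
have qp : q^-1 + p^-1 = 1 by rewrite addrC.
rewrite (coderivative_diff pq)// dJxE; apply/seteqP; split => [z /= hz|_ -> h].
  apply: ell_ext => n.
  by rewrite -(pairing_delta p1) hz -dJ_selfadjoint pairing_delta.
by rewrite dJ_selfadjoint.
Qed.

End Jmap_derivative.

Theorem theorem6p3 (R : realType) (p q : R) (p3 : 3 < p)
    (pq : p^-1 + q^-1 = 1) :
  let p1 : 1 <= p := gt3_ge1 p3 in
  let q1 : 1 <= q := gt3_conj_ge1 p3 pq in
  let J : ell p1 -> ell q1 := @Jmap R p q p1 q1 pq in
  mordukhovich_differentiable J /\
  forall xbar : ell p1,
    let DJ : ell p1 -> ell q1 := mordukhovich_derivative J xbar in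
    let A : nat -> nat -> R :=
      fun i j => (p - 1) * infdiag (fun n => `|xbar n| `^ (p - 2)) i j in
    [/\ differentiable J xbar,
        DJ = 'd J xbar :> (ell p1 -> ell q1),
        forall v : ell p1,
          DJ v = rowmul v A :> (nat -> R) /\
          'd J xbar v = rowmul v A :> (nat -> R),
        pointwise_multiplication DJ /\
        (forall (v : ell p1) (n : nat),
          DJ v n = (p - 1) * `|xbar n| `^ (p - 2) * v n /\
          'd J xbar v n = (p - 1) * `|xbar n| `^ (p - 2) * v n)
      & forall v y : ell p1,
          [/\ cvgn (series (fun n => `|xbar n| `^ (p - 2) * y n * v n)),
              pairing (DJ y) v = pairing y ('d J xbar v)
            & pairing y ('d J xbar v) =
              (p - 1) *
              limn (series (fun n => `|xbar n| `^ (p - 2) * y n * v n))]].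
Proof.
move=> p1 q1 J; have p2 : 2 < p by rewrite (lt_trans _ p3)// ltr_nat.
have coJ x y : coderivative J x y = [set dJ q1 pq p2 x y].
  exact: coderivative_Jmap.
split=> [x y|x DJ A]; first by exists (dJ q1 pq p2 x y).
have [dJx dE] := Jmap_differentiable q1 pq p2 p3 x.
have DJE : DJ = dJ q1 pq p2 x.
  by apply/funext => y; rewrite /DJ /mordukhovich_derivative coJ;
     rewrite (get_subset1 (x := dJ q1 pq p2 x y))// => z w /= -> ->.
have AE : A = infdiag (fun n => (p - 1) * `|x n| `^ (p - 2)).
  apply/funext => i; apply/funext => j; rewrite /A /infdiag.
  by case: ifP; rewrite ?mulr0.
have dJA v : dJ q1 pq p2 x v = rowmul v A :> (nat -> R).
  by rewrite AE rowmul_infdiag; apply/funext => n; rewrite dJE mulrC.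
split.
- exact: dJx.
- by rewrite DJE dE.
- by move=> v; rewrite DJE dE.
- rewrite DJE dE; split => [|v n]; last by rewrite dJE.
  by exists (fun n => (p - 1) * `|x n| `^ (p - 2)) => v n; rewrite dJE.
move=> v y; rewrite DJE dE dJ_selfadjoint.
pose u (n : nat) : R := `|x n| `^ (p - 2) * y n * v n.
have r0 : p - 1 != 0 by rewrite gt_eqF//; lra.
have uE : (fun n => y n * dJ q1 pq p2 x v n) = (p - 1) *: u.
  by apply/funext => n; rewrite dJE -[RHS]/((p - 1) * u n) /u; ring.
have cu : cvgn (series u).
  rewrite -[u](scalerK r0) -uE; apply: is_cvg_seriesZ; exact: is_cvg_pairing.
by split => //; rewrite /pairing uE lim_seriesZ.
Qed.
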